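(* For any two graphs $G_1$ and $G_2$, $\mathcal{A}(G_1+G_2)=\mathcal{A}(G_1)+\mathcal{A}(G_2)$.
   Context: All graphs are finite, simple, undirected and nonempty. A coloring of a graph $G$ assigns colors to its vertices so that adjacent vertices receive different colors; two colorings are equivalent if they induce the same partition of the vertex set into color classes. $S(G,k)$ denotes the number of non-equivalent colorings of $G$ using exactly $k$ colors. Set $\mathcal{B}(G)=\sum_{k\ge1}S(G,k)$, $\mathcal{T}(G)=\sum_{k\ge1}kS(G,k)$ and $\mathcal{A}(G)=\mathcal{T}(G)/\mathcal{B}(G)$. The join $G_1+G_2$ is obtained from the disjoint union of $G_1$ and $G_2$ by adding all edges between a vertex of $G_1$ and a vertex of $G_2$. *)

(* Defs.v *)
From mathcomp Require Import all_boot all_order all_algebra.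

Set Implicit Arguments.
Unset Strict Implicit.
Unset Printing Implicit Defensive.

Import GRing.Theory.

Record sgraph := SGraph {
  vertex :> finType;
  edge : rel vertex;
  edge_sym : symmetric edge;
  edge_irrefl : irreflexive edge;
  vertex_gt0 : 0 < #|vertex|
}.

Section Coloring.
Variable G : sgraph.

Definition is_coloring k (f : {ffun G -> 'I_k}) : bool :=
  [forall x, forall y, edge x y ==> (f x != f y)].

Definition uses_all_colors k (f : {ffun G -> 'I_k}) : bool :=
  [forall c, exists x, f x == c].

Definition color_classes k (f : {ffun G -> 'I_k}) : {set {set G}} :=
  preim_partition f [set: G].

(* Colorings are equivalent when they have the same color classes, so the
   equivalence classes are counted by the partitions that colorings induce. *)
Definition nb_colorings k : nat :=
  #|[set color_classes f |
      f : {ffun G -> 'I_k} & is_coloring f && uses_all_colors f]|.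

(* The sums below stop at k = #|G|: all later terms vanish. *)
Lemma nb_colorings_eq0 k : #|G| < k -> nb_colorings k = 0.
Proof.
move=> ltGk; apply/eqP; rewrite cards_eq0; apply/eqP/setP=> P; rewrite inE.
apply/negP=> /imsetP[f]; rewrite inE => /andP[_ /forallP onto] _.
have : #|'I_k| <= #|G|.
  rewrite -(cardsT 'I_k) -(cardsT G).
  apply: leq_trans (leq_imset_card f [set: G]).
  apply/subset_leq_card/subsetP=> c _.
  by have /existsP[x /eqP <-] := onto c; apply: imset_f.
by rewrite card_ord leqNgt ltGk.
Qed.

Definition calB : nat := \sum_(1 <= k < #|G|.+1) nb_colorings k.

Definition calT : nat := \sum_(1 <= k < #|G|.+1) k * nb_colorings k.

Definition calA : rat := (calT%:R / calB%:R)%R.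

(* The denominator of calA is nonzero. *)
Lemma calB_gt0 : 0 < calB.
Proof.
have G0 := vertex_gt0 G.
rewrite /calB big_nat_recr //= addn_gt0; apply/orP; right.
rewrite card_gt0; apply/set0Pn.
pose f : {ffun G -> 'I_#|G|} := [ffun x => enum_rank x].
exists (color_classes f); apply: imset_f; rewrite inE; apply/andP; split.
  apply/forallP=> x; apply/forallP=> y; apply/implyP=> exy; rewrite !ffunE.
  by apply: contraTneq exy => /enum_rank_inj->; rewrite edge_irrefl.
by apply/forallP=> c; apply/existsP; exists (enum_val c); rewrite ffunE enum_valK.
Qed.

End Coloring.

Section Join.
Variables G1 G2 : sgraph.

Definition join_edge : rel (G1 + G2)%type := fun u v =>
  match u, v with
  | inl x, inl y => edge x y
  | inr x, inr y => edge x y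
  | _, _ => true
  end.

Lemma join_edge_sym : symmetric join_edge.
Proof. by move=> [x|x] [y|y] //=; exact: edge_sym. Qed.

Lemma join_edge_irrefl : irreflexive join_edge.
Proof. by move=> [x|x] /=; exact: edge_irrefl. Qed.

Lemma join_vertex_gt0 : 0 < #|{: G1 + G2}|.
Proof. by rewrite card_sum addn_gt0 vertex_gt0. Qed.

Definition join : sgraph :=
  SGraph join_edge_sym join_edge_irrefl join_vertex_gt0.

End Join.

(* Main.v *)
Require Import Defs.
From mathcomp Require Import all_boot all_order all_algebra.
From mathcomp Require Import ring.

(** Equivalence classes of colorings of [G] with exactly [k] colors are the
    partitions of the vertex set into [k] independent sets, so that [calA G] is
    the average number of blocks of a partition into independent sets.  An
    independent set of a join lies on one side of it, so such a partition of
    [join G1 G2] is the union of one for [G1] and one for [G2]: the set of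
    partitions is a product, and block numbers add up. *)

Set Implicit Arguments.
Unset Strict Implicit.
Unset Printing Implicit Defensive.

Import GRing.Theory.

(** Restates cover and disjointness vertex by vertex, a form that can be checked directly on images
    and preimages of blocks. *)
Lemma partitionTP (T : finType) (P : {set {set T}}) :
  reflect [/\ set0 \notin P,
              forall x, exists2 A, A \in P & x \in A
            & {in P &, forall (A B : {set T}) x, x \in A -> x \in B -> A = B}]
          (partition P [set: T]).
Proof.
apply: (iffP and3P) => [[/eqP covP tiP P0]|[P0 covP meetP]]; split=> //.
- by move=> x; apply/bigcupP; rewrite -/(cover P) covP.
- move=> A B PA PB x Ax Bx.
  by rewrite -(def_pblock tiP PA Ax) (def_pblock tiP PB Bx).
- by apply/eqP/setP=> x; rewrite inE; apply/bigcupP/covP.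
apply/trivIsetP=> A B PA PB; apply: contra_neqT => /pred0Pn[x /andP[Ax Bx]].
exact: (meetP A B PA PB x).
Qed.

(** * Colorings as partitions into independent sets *)

Section StablePartition.
Variable G : sgraph.

Definition independent (A : {set G}) : bool :=
  [forall x in A, forall y in A, ~~ edge x y].

Lemma independentP (A : {set G}) :
  reflect {in A &, forall x y, ~~ edge x y} (independent A).
Proof.
apply: (iffP forall_inP) => [ind x y Ax Ay | ind x Ax].
  exact: (forall_inP (ind x Ax)).
by apply/forall_inP=> y Ay; apply: ind.
Qed.

Definition stable_partition (P : {set {set G}}) : bool :=
  partition P [set: G] && [forall A in P, independent A].

Lemma stable_partitionP (P : {set {set G}}) :
  reflect (partition P [set: G] /\ {in P, forall A, independent A})
          (stable_partition P).
Proof.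
apply: (iffP andP) => -[part ind]; split=> //; last exact/forall_inP.
by move=> A PA; apply: (forall_inP ind).
Qed.

(** Surjectivity matters here: a color without vertices would contribute [set0] on the right,
    whereas color classes are never empty. *)
Lemma color_classesE k (f : {ffun G -> 'I_k}) :
  uses_all_colors f -> color_classes f = [set f @^-1: [set c] | c : 'I_k].
Proof.
move=> /forallP onto; apply/setP=> A; apply/imsetP/imsetP=> [[x _ ->]|[c _ ->]].
  by exists (f x) => //; apply/setP=> y; rewrite !inE eq_sym.
have /existsP[x /eqP fx] := onto c; exists x => //.
by apply/setP=> y; rewrite !inE fx eq_sym.
Qed.

Lemma card_color_classes k (f : {ffun G -> 'I_k}) :
  uses_all_colors f -> #|color_classes f| = k.
Proof.
move=> onto; rewrite color_classesE // card_imset ?card_ord // => c d /setP.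
have /existsP[x /eqP fx] := forallP onto c.
by move/(_ x); rewrite !inE fx eqxx => /esym/eqP.
Qed.

Lemma stable_color_classes k (f : {ffun G -> 'I_k}) :
  is_coloring f -> stable_partition (color_classes f).
Proof.
move=> col; apply/stable_partitionP; split; first exact: preim_partitionP.
move=> _ /imsetP[x _ ->]; apply/independentP=> y z; rewrite !inE.
move=> /eqP fy /eqP fz; apply/negP=> eyz.
by have /implyP/(_ eyz) := forallP (forallP col y) z; rewrite -fy -fz eqxx.
Qed.

(** Each vertex is colored by the rank of its block in [P]; adjacent vertices lie in different
    blocks because blocks are independent. *)
Lemma stable_partition_coloring (P : {set {set G}}) :
  stable_partition P ->
  exists2 f : {ffun G -> 'I_#|P|},
    is_coloring f && uses_all_colors f & color_classes f = P.
Proof.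
move=> /stable_partitionP[partP ind]; have /and3P[/eqP covP tiP P0] := partP.
have Pb x : pblock P x \in P by rewrite pblock_mem // covP.
have /card_gt0P[x0 _] := vertex_gt0 G.
(* [enum_rank_in] needs some element of [P]; the block of [x0] serves, and [x0] exists since graphs
   are nonempty. *)
pose f : {ffun G -> 'I_#|P|} := [ffun x => enum_rank_in (Pb x0) (pblock P x)].
have fE x y : (f x == f y) = (pblock P x == pblock P y).
  rewrite !ffunE; apply/eqP/eqP=> [|-> //].
  exact: (can_in_inj (enum_rankK_in (Pb x0)) (Pb x) (Pb y)).
exists f; first (apply/andP; split).
- apply/forallP=> x; apply/forallP=> y; apply/implyP=> exy.
  rewrite fE eq_pblock ?covP //; apply: contraL exy => Pxy.
  by apply: (independentP _ (ind _ (Pb x))) => //; rewrite mem_pblock covP.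
- apply/forallP=> c; apply/existsP.
  have Pc : enum_val c \in P := enum_valP c.
  have [x cx] : exists x, x \in enum_val c.
    by apply/set0Pn; apply: contraNneq P0 => <-.
  by exists x; rewrite ffunE (def_pblock tiP Pc cx) enum_valK_in.
rewrite -[RHS](equivalence_partition_pblock partP).
apply: eq_imset => x; apply/setP=> y.
by rewrite !inE fE eq_pblock ?covP.
Qed.

Lemma nb_coloringsE k :
  nb_colorings G k = #|[set P | stable_partition P & #|P| == k]|.
Proof.
apply: eq_card => P; rewrite [in RHS]inE; apply/imsetP/andP.
  case=> f; rewrite inE => /andP[col onto] ->.
  by rewrite stable_color_classes // card_color_classes.
case=> /stable_partition_coloring[f f_ok fP] /eqP <-.
by exists f; rewrite ?inE.
Qed.

(** These bounds place [#|P|] in the range of summation of [calB] and [calT]. *)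
Lemma card_stable_partition P :
  stable_partition P -> 0 < #|P| <= #|G|.
Proof.
move=> stP; apply/andP; split.
  rewrite card_gt0; apply: contraTneq stP => ->.
  apply/negP=> /stable_partitionP[/cover_partition/setP cov _].
  have /card_gt0P[x _] := vertex_gt0 G.
  by have := cov x; rewrite /cover big_set0 !inE.
(* With more blocks than vertices, [P] would be counted by a number of colorings that vanishes. *)
rewrite leqNgt; apply/negP=> /nb_colorings_eq0/eqP.
rewrite nb_coloringsE cards_eq0 => /eqP/setP/(_ P).
by rewrite !inE stP eqxx.
Qed.

(** After exchanging the sums, each stable partition contributes only at [k = #|P|]. Constant [F]
    gives [calB], the identity gives [calT]. *)
Lemma sum_nb_colorings (F : nat -> nat) :
  \sum_(1 <= k < #|G|.+1) F k * nb_colorings G k =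
  \sum_(P | stable_partition P) F #|P|.
Proof.
under eq_bigr => k _.
  rewrite nb_coloringsE -sum1dep_card big_mkcondr big_distrr /=.
  over.
rewrite exchange_big; apply: eq_bigr => P /card_stable_partition Pn.
rewrite (bigD1_seq #|P|) ?iota_uniq ?mem_index_iota //= eqxx muln1.
by rewrite big1 ?addn0 // => k /negPf nk; rewrite eq_sym nk muln0.
Qed.

Lemma calBE : calB G = \sum_(P | stable_partition P) 1.
Proof.
rewrite -(sum_nb_colorings (fun=> 1)).
by apply: eq_bigr => k _; rewrite mul1n.
Qed.

Lemma calTE : calT G = \sum_(P | stable_partition P) #|P|.
Proof. exact: (sum_nb_colorings id). Qed.

End StablePartition.

(** * Stable partitions of a join *)

Section Join.
Variables G1 G2 : sgraph.

Local Notation in1 := (@inl G1 G2).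
Local Notation in2 := (@inr G1 G2).

Let inl_inj : injective in1. Proof. by move=> x y []. Qed.
Let inr_inj : injective in2. Proof. by move=> x y []. Qed.

Lemma mem_imset_inl_inr (A : {set G1}) y : (in2 y \in in1 @: A) = false.
Proof. by apply/negP=> /imsetP[]. Qed.

Lemma mem_imset_inr_inl (A : {set G2}) x : (in1 x \in in2 @: A) = false.
Proof. by apply/negP=> /imsetP[]. Qed.

Definition join_partition (P : {set {set G1}} * {set {set G2}}) :
    {set {set join G1 G2}} :=
  [set in1 @: A | A : {set G1} in P.1] :|:
  [set in2 @: A | A : {set G2} in P.2].

(** Blocks are selected by their images: taking preimages of all blocks instead would add [set0] for
    each block on the other side. *)
Definition split_partition (P : {set {set join G1 G2}}) :
    {set {set G1}} * {set {set G2}} :=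
  ([set A : {set G1} | in1 @: A \in P], [set A : {set G2} | in2 @: A \in P]).

(** The hypothesis excludes the only common image, since both embeddings send [set0] to [set0]. *)
Lemma imset_inl_neq (A : {set G1}) (B : {set G2}) :
  A != set0 -> in1 @: A != in2 @: B.
Proof.
case/set0Pn=> x Ax; apply/eqP=> /setP/(_ (in1 x)).
by rewrite mem_imset // Ax mem_imset_inr_inl.
Qed.

Lemma join_partition_disjoint (P1 : {set {set G1}}) (P2 : {set {set G2}}) :
  stable_partition P1 ->
  [disjoint [set in1 @: A | A : {set G1} in P1]
          & [set in2 @: A | A : {set G2} in P2]].
Proof.
case/stable_partitionP=> /and3P[_ _ P10] _.
rewrite -setI_eq0; apply/eqP/setP=> B; rewrite !inE; apply/negP.
case/andP=> /imsetP[A1 PA1 ->] /imsetP[A2 _] /eqP; apply/negP/imset_inl_neq.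
by apply: contraNneq P10 => <-.
Qed.

Lemma card_join_partition P1 P2 :
  stable_partition P1 -> #|join_partition (P1, P2)| = #|P1| + #|P2|.
Proof.
move=> st1; rewrite cardsU (eqP (_ : _ :&: _ == set0)).
  by rewrite cards0 subn0 !card_imset //; exact: imset_inj.
by rewrite setI_eq0 join_partition_disjoint.
Qed.

Lemma join_partitionK P1 P2 :
  stable_partition P1 -> stable_partition P2 ->
  split_partition (join_partition (P1, P2)) = (P1, P2).
Proof.
case/stable_partitionP=> /and3P[_ _ P10] _.
case/stable_partitionP=> /and3P[_ _ P20] _.
congr (_, _); apply/setP=> A; rewrite !inE mem_imset; try exact: imset_inj.
  apply/orP/idP=> [[//|/imsetP[B PB eqAB]]|]; last by left.
  (* An image from the left can equal one from the right only if both sets are empty, but [P2] has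
     no empty block. *)
  have [A0|A0] := eqVneq A set0; last by case/eqP: (imset_inl_neq B A0).
  move/esym/eqP: eqAB; rewrite A0 imset0 imset_eq0 => /eqP B0.
  by rewrite -B0 PB in P20.
apply/orP/idP=> [[/imsetP[B PB /esym eqAB]|//]|]; last by right.
have B0 : B != set0 by apply: contraNneq P10 => <-.
by case/eqP: (imset_inl_neq A B0).
Qed.

Lemma stable_join_partition P1 P2 :
  stable_partition P1 -> stable_partition P2 ->
  stable_partition (join_partition (P1, P2)).
Proof.
case/stable_partitionP=> /partitionTP[P10 cov1 meet1] ind1.
case/stable_partitionP=> /partitionTP[P20 cov2 meet2] ind2.
apply/stable_partitionP; split; [apply/partitionTP; split|].
- apply/negP; rewrite inE => /orP[] /imsetP[A PA /esym/eqP];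
    rewrite imset_eq0 => /eqP A0; first by rewrite -A0 PA in P10.
  by rewrite -A0 PA in P20.
- case=> [x|y].
    have [A PA Ax] := cov1 x.
    by exists (in1 @: A); [rewrite inE imset_f | rewrite imset_f].
  have [A PA Ay] := cov2 y.
  by exists (in2 @: A); [rewrite inE orbC imset_f | rewrite imset_f].
- move=> A B; rewrite !inE.
  (* Four cases, by the sides of the two blocks; in the mixed ones no vertex is shared. *)
  case/orP=> /imsetP[A' PA ->] /orP[] /imsetP[B' PB ->] _ /imsetP[x Ax ->].
  + by rewrite mem_imset // => Bx; rewrite (meet1 A' B' PA PB x).
  + by rewrite mem_imset_inr_inl.
  + by rewrite mem_imset_inl_inr.
  by rewrite mem_imset // => Bx; rewrite (meet2 A' B' PA PB x).
move=> A; rewrite inE => /orP[] /imsetP[A' PA ->]; apply/independentP.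
  move=> _ _ /imsetP[x Ax ->] /imsetP[y Ay ->] /=.
  exact: (independentP _ (ind1 _ PA)).
move=> _ _ /imsetP[x Ax ->] /imsetP[y Ay ->] /=.
exact: (independentP _ (ind2 _ PA)).
Qed.

(** In the join, [inl x] is adjacent to every vertex of [G2], so [B] contains none of them. *)
Lemma independent_inl (B : {set join G1 G2}) x :
  independent B -> inl x \in B -> B = in1 @: (in1 @^-1: B).
Proof.
move=> /independentP ind Bx; apply/setP=> -[y|y].
  by rewrite mem_imset // inE.
by rewrite mem_imset_inl_inr; apply/negP=> By; have := ind _ _ Bx By.
Qed.

Lemma independent_inr (B : {set join G1 G2}) x :
  independent B -> inr x \in B -> B = in2 @: (in2 @^-1: B).
Proof.
move=> /independentP ind Bx; apply/setP=> -[y|y].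
  by rewrite mem_imset_inr_inl; apply/negP=> By; have := ind _ _ Bx By.
by rewrite mem_imset // inE.
Qed.

(** Covering is where the join edges enter: the block through a vertex lies wholly on the side of
    that vertex, so its preimage is one of the selected blocks. *)
Lemma stable_split_partition P :
  stable_partition P ->
  stable_partition (split_partition P).1 /\
  stable_partition (split_partition P).2.
Proof.
case/stable_partitionP=> /partitionTP[P0 covP meetP] indP.
split; apply/stable_partitionP; (split; [apply/partitionTP; split|]) => /=.
- by rewrite inE imset0.
- move=> x; have [B PB Bx] := covP (inl x).
  by exists (in1 @^-1: B); rewrite inE // -(independent_inl (indP _ PB) Bx).
- move=> A B; rewrite !inE => PA PB x Ax Bx; apply: (imset_inj inl_inj).
  by apply: (meetP _ _ PA PB (inl x)); rewrite imset_f.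
- move=> A; rewrite inE => PA; apply/independentP=> x y Ax Ay.
  by apply: (independentP _ (indP _ PA) (inl x) (inl y)); rewrite imset_f.
- by rewrite inE imset0.
- move=> x; have [B PB Bx] := covP (inr x).
  by exists (in2 @^-1: B); rewrite inE // -(independent_inr (indP _ PB) Bx).
- move=> A B; rewrite !inE => PA PB x Ax Bx; apply: (imset_inj inr_inj).
  by apply: (meetP _ _ PA PB (inr x)); rewrite imset_f.
- move=> A; rewrite inE => PA; apply/independentP=> x y Ax Ay.
  by apply: (independentP _ (indP _ PA) (inr x) (inr y)); rewrite imset_f.
Qed.

(** A block is nonempty, and any of its vertices determines the side that contains it, so no block
    is lost by splitting. *)
Lemma split_partitionK P :
  stable_partition P -> join_partition (split_partition P) = P.
Proof.
case/stable_partitionP=> /partitionTP[P0 _ _] indP.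
apply/setP=> B; rewrite inE; apply/orP/idP => [|PB].
  by case=> /imsetP[A]; rewrite inE => PA ->.
have /set0Pn[[x|x] Bx] : B != set0 by apply: contraNneq P0 => <-.
  have eqB := independent_inl (indP _ PB) Bx.
  by left; rewrite eqB imset_f // inE -eqB.
have eqB := independent_inr (indP _ PB) Bx.
by right; rewrite eqB imset_f // inE -eqB.
Qed.

Lemma sum_stable_join (F : nat -> nat) :
  \sum_(P : {set {set join G1 G2}} | stable_partition P) F #|P| =
  \sum_(P1 : {set {set G1}} | stable_partition P1)
    \sum_(P2 : {set {set G2}} | stable_partition P2) F (#|P1| + #|P2|).
Proof.
rewrite pair_big /= (reindex_onto join_partition split_partition); last first.
  exact: split_partitionK.
rewrite [RHS](eq_bigr (fun P => F #|join_partition P|)); last first.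
  by move=> [P1 P2] /andP[st1 st2]; rewrite card_join_partition.
(* Reindexing ranges over pairs whose join is stable and splits back to the pair; these are exactly
   the pairs of stable partitions. *)
apply: eq_bigl => -[P1 P2] /=; apply/andP/andP=> [[st /eqP eqP12]|[st1 st2]].
  by have := stable_split_partition st; rewrite eqP12 => -[].
by rewrite stable_join_partition // join_partitionK.
Qed.

(** * Counts for the join and their quotient *)

Lemma calB_join : calB (join G1 G2) = calB G1 * calB G2.
Proof.
rewrite !calBE (sum_stable_join (fun=> 1)) big_distrl /=.
by apply: eq_bigr => P1 _; rewrite mul1n.
Qed.

(** In the sum of [#|P1| + #|P2|] over all pairs, each size on one side occurs once for every stable
    partition of the other side. *)
Lemma calT_join :
  calT (join G1 G2) = calT G1 * calB G2 + calB G1 * calT G2.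
Proof.
rewrite !calTE !calBE (sum_stable_join id) !big_distrl -big_split /=.
apply: eq_bigr => P1 _; rewrite big_distrr mul1n -big_split /=.
by apply: eq_bigr => P2 _; rewrite muln1.
Qed.

End Join.

Theorem theorem1 (G1 G2 : sgraph) : calA (join G1 G2) = (calA G1 + calA G2)%R.
Proof.
have B0 (G : sgraph) : ((calB G)%:R != 0 :> rat)%R.
  by rewrite Num.Theory.pnatr_eq0 -lt0n calB_gt0.
(* Dividing the sum for [calT] by the product for [calB] cancels one nonzero factor in each
   summand. *)
rewrite /calA calT_join calB_join natrD !natrM.
by field; rewrite !B0.
Qed.
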